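(* Let $R_3=\{(a,b): a,b\in\{0,1,2\}\}\cup\{(3,3)\}$ and $R_4=\{(0,0)\}\cup\{(a,b): a,b\in\{1,2,3\}\}$. Then the four mesh patterns $(123,R_3)$, $(321,R_3)$, $(123,R_4)$, $(321,R_4)$ are Wilf-equivalent, i.e., for every $n\ge 1$ the number of permutations in $S_n$ avoiding each of them is the same.
   Context: $S_n$ is the set of permutations of $\{1,\dots,n\}$. A mesh pattern of length $k$ is a pair $(\tau,R)$ with $\tau\in S_k$ and $R\subseteq\{0,\dots,k\}^2$; the element $(a,b)\in R$ is the ''shaded box'' whose corners are $(a,b),(a,b+1),(a+1,b+1),(a+1,b)$ in the plot of $\tau$ (first coordinate = position, second = value). An occurrence of $(\tau,R)$ in $\pi=\pi_1\cdots\pi_n\in S_n$ is a tuple of indices $i_1<\dots<i_k$ such that $\pi_{i_1}\cdots\pi_{i_k}$ is order-isomorphic to $\tau$ and, setting $i_0=0$, $i_{k+1}=n+1$, letting $v_1<\dots<v_k$ be the values $\pi_{i_1},\dots,\pi_{i_k}$ in increasing order and $v_0=0$, $v_{k+1}=n+1$, for every $(a,b)\in R$ there is no index $m$ with $i_a<m<i_{a+1}$ and $v_b<\pi_m<v_{b+1}$. A permutation avoids a mesh pattern if it has no occurrence of it. *)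

(* Defs.v *)
From mathcomp Require Import all_boot all_fingroup.
Set Implicit Arguments.
Unset Strict Implicit.
Unset Printing Implicit Defensive.

(* A permutation in S_n is [pi : 'S_n], acting on {0, ..., n-1}; positions and
   values are shifted by one ([.+1]) below, so that the boundary conventions
   i_0 = v_0 = 0 and i_{k+1} = v_{k+1} = n+1 can be used literally. *)

(* Boxes (a, b), with 0 <= a, b <= k, are (position, value) pairs. *)
Definition mesh_pattern (k : nat) : Type :=
  ('S_k * {set 'I_k.+1 * 'I_k.+1})%type.

Section Occurrence.

Variables (n k : nat) (pi : 'S_n) (p : mesh_pattern k) (i : {ffun 'I_k -> 'I_n}).

Definition increasing_indices : bool :=
  [forall a : 'I_k, forall b : 'I_k, (a < b) ==> (i a < i b)].

Definition order_isomorphic : bool :=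
  [forall a : 'I_k, forall b : 'I_k, (pi (i a) < pi (i b)) == (p.1 a < p.1 b)].

(* i_0, i_1, ..., i_k, i_{k+1} *)
Definition position_bounds : seq nat :=
  0 :: rcons [seq (i a).+1 | a <- enum 'I_k] n.+1.

(* v_0, v_1, ..., v_k, v_{k+1} *)
Definition value_bounds : seq nat :=
  0 :: rcons (sort leq [seq (pi (i a)).+1 | a <- enum 'I_k]) n.+1.

Definition in_box (a b : nat) (m : 'I_n) : bool :=
  (nth 0 position_bounds a < m.+1 < nth 0 position_bounds a.+1) &&
  (nth 0 value_bounds b < (pi m).+1 < nth 0 value_bounds b.+1).

Definition occurrence : bool :=
  [&& increasing_indices, order_isomorphic
    & [forall box in p.2, ~~ [exists m : 'I_n, in_box box.1 box.2 m]]].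

End Occurrence.

Definition avoids (n k : nat) (pi : 'S_n) (p : mesh_pattern k) : bool :=
  ~~ [exists i : {ffun 'I_k -> 'I_n}, occurrence pi p i].

Definition wilf_equivalent (k l : nat) (p : mesh_pattern k) (q : mesh_pattern l)
    : Prop :=
  forall n : nat, 1 <= n ->
    #|[set pi : 'S_n | avoids pi p]| = #|[set pi : 'S_n | avoids pi q]|.

Definition perm123 : 'S_3 := 1%g.

Definition perm321 : 'S_3 := perm (@rev_ord_inj 3).

Definition R3 : {set 'I_4 * 'I_4} :=
  [set box : 'I_4 * 'I_4 |
    (box.1 <= 2) && (box.2 <= 2)
    || (box.1 == 3 :> nat) && (box.2 == 3 :> nat)].

Definition R4 : {set 'I_4 * 'I_4} :=
  [set box : 'I_4 * 'I_4 |
    (box.1 == 0 :> nat) && (box.2 == 0 :> nat)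
    || (1 <= box.1) && (1 <= box.2)].

(* Main.v *)
Require Import Defs.
From mathcomp Require Import all_boot all_fingroup.
From mathcomp Require Import zify.

(** R4 is R3 rotated by 180 degrees, so only R3 matters. An occurrence of
    (123, R3) or (321, R3) is a box [0, x] x [0, y] that contains exactly three
    points, monotone in the prescribed direction, has points in its last column
    and in its last row, and has no point strictly to its north-east. When
    nothing lies to the north-east, counting shows that the box holds exactly
    three points iff (x, y) lies on a fixed antidiagonal, so x determines it.

    By inclusion-exclusion it is enough to show that, for every set S of
    corners, as many permutations have all their boxes with corner in S
    increasing as decreasing. Call two permutations equivalent if they agree
    outside the union of these boxes. The conditions on the boxes other than
    monotonicity are invariant under this equivalence, and each class contains
    exactly one permutation with all boxes increasing (resp.
    decreasing): one exists because it maximizes (resp. minimizes) the sum of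
    c * pi c over the class, and it is unique because in the topmost row where
    two candidates differ, one of them has a pair in the wrong order. *)

Set Implicit Arguments.
Unset Strict Implicit.
Unset Printing Implicit Defensive.

(** * Inclusion-exclusion for set-valued statistics *)

Lemma card_fibres_eq (T I : finType) (A B : T -> {set I}) :
  (forall S : {set I}, #|[set t | S \subset A t]| = #|[set t | S \subset B t]|) ->
  forall S, #|[set t | A t == S]| = #|[set t | B t == S]|.
Proof.
(* Downward induction on [S]: the count over all supersets splits by the exact value, and the proper
   supersets contribute equally by induction, so the terms for [S] itself agree. *)
move=> AB S; have [k] := ubnP #|~: S|; elim: k S => // k IH S ltSk.
have split_sup (C : T -> {set I}) :
    #|[set t | S \subset C t]| =
    #|[set t | C t == S]| +
    \sum_(S' : {set I} | S \proper S') #|[set t | C t == S']|.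
  rewrite -sum1_card.
  rewrite (partition_big C (fun S' : {set I} => S \subset S')) /=; last first.
    by move=> t; rewrite inE.
  rewrite (bigD1 S) //=; congr (_ + _).
    rewrite sum1dep_card; apply: eq_card => t; rewrite !inE.
    by case: eqP => [->|]; rewrite ?subxx ?andbF.
  apply: eq_big => [S'|S' /andP[sSS' _]].
    by rewrite properEneq eq_sym andbC.
  rewrite sum1dep_card; apply: eq_card => t; rewrite !inE.
  by case: eqP => [->|]; rewrite ?sSS' ?andbF.
have := AB S; rewrite !split_sup.
rewrite (eq_bigr (fun S' : {set I} => #|[set t | B t == S']|)).
  by move/addIn.
move=> S' ltSS'; apply: IH; have := proper_card ltSS'.
have := cardsC S; have := cardsC S'; lia.
Qed.

(** * Boxes with corner on the antidiagonal *)

Section Boxes.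

Variable n : nat.
Implicit Types (pi rho : 'S_n) (x c d m : 'I_n) (S : {set 'I_n}) (b : bool).

(* The box with right column x has top row n + 1 - x; the additive form avoids
   truncated subtraction. *)
Definition inb x (c v : nat) : bool := (c <= x) && (v + x <= n.+1).

(** The number of points in the box is not prescribed here: by [card_box] it is three. *)
Definition tight pi x : bool :=
  [&& inb x x (pi x), [exists c : 'I_n, inb x c (pi c) && (pi c + x == n.+1)]
    & [forall m : 'I_n, (x < m) ==> (pi m + x <= n.+1)]].

Definition mono b pi x : bool :=
  [forall c : 'I_n, forall d : 'I_n, [&& inb x c (pi c), inb x d (pi d) & c < d]
    ==> ((pi c < pi d) == b)].

Definition corners b pi : {set 'I_n} := [set x | tight pi x && mono b pi x].

Definition region S (c v : nat) : bool := [exists x in S, inb x c v].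

Definition same_outside S pi rho : bool :=
  [forall c : 'I_n, (pi c == rho c) || region S c (pi c) && region S c (rho c)].

Lemma same_outside_refl S pi : same_outside S pi pi.
Proof. by apply/forallP => c; rewrite eqxx. Qed.

Lemma same_outside_sym S pi rho : same_outside S pi rho = same_outside S rho pi.
Proof.
by apply: eq_forallb => c; rewrite eq_sym [region _ _ _ && _]andbC.
Qed.

Lemma same_outside_trans S : transitive (same_outside S).
Proof.
move=> rho pi sg /forallP pr /forallP rs; apply/forallP => c.
case/orP: (pr c) (rs c) => [/eqP-> //|/andP[p1 p2]].
by case/orP => [/eqP<-|/andP[p3 p4]]; rewrite p1 ?p2 ?p4 orbT.
Qed.

(** A box meeting column [c] has its right column [z >= c >= x], and boxes get lower as they extend
    to the right. *)
Lemma region_corner S x c v : x <= c -> region S c v -> v + x <= n.+1.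
Proof. by move=> xc /'exists_andP[z [_ /andP[]]]; lia. Qed.

Lemma tight_same_outside S pi rho x :
  x \in S -> same_outside S pi rho -> tight pi x -> tight rho x.
Proof.
move=> Sx /forallP pr /and3P[/andP[_ bx] + /forallP NE].
case/existsP=> c /andP[bc /eqP ec].
apply/and3P; split.
- rewrite /inb leqnn /=; case/orP: (pr x) => [/eqP<- //|/andP[_ r]].
  exact: region_corner (leqnn x) r.
(* [d] is the column of the point of [rho] in the top row [n + 1 - x]. *)
- pose d := (rho^-1 (pi c))%g; have rd : rho d = pi c by rewrite permKV.
  apply/existsP; exists d; rewrite /inb rd ec leqnn eqxx !andbT.
  case/orP: (pr d) => [/eqP|/andP[_]].
    by rewrite rd => /perm_inj ->; case/andP: bc.
  (* A box [z] that reaches the row [n + 1 - x] has [z <= x], so [d <= z <= x]. *)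
  by rewrite rd => /'exists_andP[z [_ /andP[]]]; lia.
- apply/forallP => m; apply/implyP => xm.
  case/orP: (pr m) => [/eqP<-|/andP[_ r]]; first exact: (implyP (NE m)).
  exact: region_corner (ltnW xm) r.
Qed.

(* The index y decreases from the top row: above it pi and rho already agree. *)
Lemma mono_unique S b pi rho :
    same_outside S pi rho ->
    {in S, forall x, mono b pi x} -> {in S, forall x, mono b rho x} ->
  pi = rho.
Proof.
move=> /forallP pr mp mr; apply/invg_inj/permP => y; apply/eqP.
have [k] := ubnP (n - y); elim: k y => // k IH y ltk.
have IH' (z : 'I_n) : y < z -> (pi^-1)%g z = (rho^-1)%g z.
  by move=> yz; apply/eqP/IH; have := ltn_ord z; lia.
clear k IH ltk; apply/negP => /negP ne.
wlog lt : pi rho pr mp mr IH' ne / (pi^-1)%g y < (rho^-1)%g y.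
  move=> W; case: (ltngtP ((pi^-1)%g y) ((rho^-1)%g y)) => lt.
  - exact: (W pi rho).
  - apply: (W rho pi) => //; last by rewrite eq_sym.
      by move=> c; rewrite eq_sym [region _ _ _ && _]andbC.
    by move=> z /IH'->.
  - by case/eqP: ne; apply: val_inj.
set c := (pi^-1)%g y in lt ne; set d := (rho^-1)%g y in lt ne.
have pc : pi c = y by rewrite permKV.
have rd : rho d = y by rewrite permKV.
have pd : pi d != y by rewrite -pc (inj_eq perm_inj) eq_sym.
have rc : rho c != y by rewrite -rd (inj_eq perm_inj).
(* Values above [y] sit in the same columns of [pi] and [rho], and column [d] of [rho] is taken by
   [y]. *)
have ltd : pi d < y.
  rewrite ltn_neqAle [_ != _]pd leqNgt; apply/negP => /IH'.
  rewrite permK => e; by move: pd; rewrite -(permKV rho (pi d)) -e rd eqxx.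
have ltc : rho c < y.
  rewrite ltn_neqAle [_ != _]rc leqNgt; apply/negP => /IH'.
  rewrite permK => e; by move: rc; rewrite -(permKV pi (rho c)) e pc eqxx.
(* A box containing [(d, y)] contains the points of both permutations in columns [c < d]. There [pi]
   descends from [y] and [rho] ascends to [y], so they cannot both obey [b]. *)
have /'exists_andP[x [Sx bx]] : region S d y.
  by case/orP: (pr d); rewrite rd ?(negPf pd) // => /andP[].
have := mp x Sx => /forallP/(_ c)/forallP/(_ d).
have := mr x Sx => /forallP/(_ c)/forallP/(_ d).
move: bx; rewrite /inb pc rd => bx.
have -> : [&& (c <= x) && (rho c + x <= n.+1),
    (d <= x) && (y + x <= n.+1) & c < d] by lia.
have -> : [&& (c <= x) && (y + x <= n.+1),
    (d <= x) && (pi d + x <= n.+1) & c < d] by lia.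
by case: b {mp mr} => /=; lia.
Qed.

Definition weight pi : nat := \sum_(c < n) c * pi c.

(** Rearrangement: the swap lowers the weight by [(d - c) * (pi d - pi c)]. *)
Lemma weight_tperm pi c d : c < d -> pi c < pi d ->
  weight (tperm c d * pi)%g < weight pi.
Proof.
move=> cd pcd; have dc : d != c by apply: contraTneq cd => ->; rewrite ltnn.
rewrite /weight (bigD1 c) //= (bigD1 d) //=.
rewrite [X in _ < X](bigD1 c) //= [X in _ < _ + X](bigD1 d) //=.
rewrite !permM tpermL tpermR !addnA.
rewrite (eq_bigr (fun i : 'I_n => i * pi i)) ?ltn_add2r; last first.
  by move=> i /andP[ic id]; rewrite permM tpermD // eq_sym.
nia.
Qed.

Lemma same_outside_tperm S pi c d x :
    x \in S -> inb x c (pi c) -> inb x d (pi d) ->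
  same_outside S pi (tperm c d * pi)%g.
Proof.
move=> Sx /andP[cx pcx] /andP[dx pdx]; apply/forallP => e; rewrite permM.
have inS (a v : nat) : inb x a v -> region S a v.
  by move=> av; apply/'exists_andP; exists x.
by case: tpermP => [->|->|_ _]; rewrite ?eqxx // !inS ?orbT // /inb ?cx ?dx.
Qed.

Lemma exists_mono S b pi :
  exists2 rho, same_outside S pi rho & {in S, forall x, mono b rho x}.
Proof.
pose P rho := same_outside S pi rho; have P0 : P pi by exact: same_outside_refl.
have swap rho (c d : 'I_n) x : P rho -> x \in S -> inb x c (rho c) ->
    inb x d (rho d) -> P (tperm c d * rho)%g.
  move=> /same_outside_trans Pr Sx ic id; apply: Pr.
  exact: same_outside_tperm ic id.
case: b.
  case: (arg_maxnP weight P0) => rho Pr maxr; exists rho => // x Sx.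
  apply/'forall_forallP => c d; apply/implyP => /and3P[ic id cd].
  rewrite eqb_id ltnNge; apply/negP => rdc.
  have := maxr _ (swap _ _ _ _ Pr Sx ic id); rewrite /= leqNgt => /negP; apply.
  (* [rho] is itself a swap of the swapped permutation, which is increasing on [c < d]. *)
  rewrite -[X in weight X < _](mulKg (tperm c d)) tpermV.
  apply: weight_tperm => //; rewrite !permM tpermL tpermR ltn_neqAle rdc andbT.
  rewrite (inj_eq val_inj) (inj_eq perm_inj).
  by apply: contraTneq cd => ->; rewrite ltnn.
case: (arg_minnP weight P0) => rho Pr minr; exists rho => // x Sx.
apply/'forall_forallP => c d; apply/implyP => /and3P[ic id cd].
rewrite eqbF_neg; apply/negP => rcd.
have := minr _ (swap _ _ _ _ Pr Sx ic id); rewrite /= leqNgt => /negP; apply.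
exact: weight_tperm.
Qed.

(** Send each permutation to an equivalent one whose boxes have direction [b']. Two permutations
    with the same image are equivalent, hence equal by [mono_unique], so this map is injective. *)
Lemma leq_card_corners S b b' :
  #|[set pi : 'S_n | S \subset corners b pi]| <=
  #|[set pi : 'S_n | S \subset corners b' pi]|.
Proof.
have /fin_all_exists2[f fS fb'] := exists_mono S b'.
rewrite -(card_in_imset (f := f)).
  apply/subset_leq_card/subsetP => _ /imsetP[pi + ->]; rewrite !inE.
  move=> /subsetP cpi; apply/subsetP => x Sx; rewrite inE fb' // andbT.
  apply: (tight_same_outside Sx (fS pi)).
  by have := cpi x Sx; rewrite inE => /andP[].
move=> pi rho; rewrite !inE => /subsetP cpi /subsetP crho e.
apply: (@mono_unique S b).
- by apply: same_outside_trans (fS pi) _; rewrite e same_outside_sym.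
- by move=> x /cpi; rewrite inE => /andP[].
- by move=> x /crho; rewrite inE => /andP[].
Qed.

Lemma card_corners0 b b' :
  #|[set pi : 'S_n | corners b pi == set0]| =
  #|[set pi : 'S_n | corners b' pi == set0]|.
Proof.
by apply: card_fibres_eq => S; apply/eqP; rewrite eqn_leq !leq_card_corners.
Qed.
End Boxes.

(** * Occurrences of patterns of length three as boxes *)

Definition monotone3 (b : bool) : 'S_3 := if b then perm123 else perm321.

Definition chain3 (b : bool) (u v w : nat) : bool :=
  if b then u < v < w else w < v < u.

Section Length3.

Variables (n : nat) (pi : 'S_n) (b : bool).

Definition ffun3 (u v w : 'I_n) : {ffun 'I_3 -> 'I_n} :=
  [ffun a : 'I_3 => nth u [:: u; v; w] a].

Definition lo3 (u v w : nat) := if b then u else w.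
Definition hi3 (u v w : nat) := if b then w else u.

Definition bounds3 (p q r : nat) := [:: 0; p.+1; q.+1; r.+1; n.+1].

Definition gap (s : seq nat) (a m : nat) : bool :=
  nth 0 s a < m.+1 < nth 0 s a.+1.

Lemma ex_ffun3 (P : {ffun 'I_3 -> 'I_n} -> bool) :
  [exists i, P i] = [exists u, exists v, exists w, P (ffun3 u v w)].
Proof.
apply/existsP/existsP => [[i Pi]|[u /existsP[v /existsP[w Pi]]]]; last first.
  by exists (ffun3 u v w).
exists (i (inord 0)); apply/existsP; exists (i (inord 1)); apply/existsP.
exists (i (inord 2)).
suff <- : i = ffun3 (i (inord 0)) (i (inord 1)) (i (inord 2)) by [].
apply/ffunP => -[[|[|[|//]]] lt]; rewrite ffunE /=; congr (i _); apply: val_inj;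
  by rewrite /= inordK.
Qed.

Lemma enum_I3 : enum 'I_3 = [:: inord 0; inord 1; inord 2].
Proof.
apply: (inj_map val_inj); rewrite val_enum_ord /=.
by rewrite !inordK.
Qed.

Lemma occurrence3E (R : {set 'I_4 * 'I_4}) (u v w : 'I_n) :
  occurrence pi (monotone3 b, R) (ffun3 u v w) =
  [&& u < v < w, chain3 b (pi u) (pi v) (pi w)
    & [forall box in R, ~~ [exists m : 'I_n,
       gap (bounds3 u v w) box.1 m &&
       gap (bounds3 (lo3 (pi u) (pi v) (pi w)) (pi v)
                    (hi3 (pi u) (pi v) (pi w))) box.2 (pi m)]]].
Proof.
have f0 : ffun3 u v w (inord 0) = u by rewrite ffunE inordK.
have f1 : ffun3 u v w (inord 1) = v by rewrite ffunE inordK.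
have f2 : ffun3 u v w (inord 2) = w by rewrite ffunE inordK.
have I3 (P : pred 'I_3) :
    [forall a, P a] = [&& P (inord 0), P (inord 1) & P (inord 2)].
  apply/forallP/and3P => [H|[H0 H1 H2] a]; first by split.
  have : a \in enum 'I_3 by rewrite mem_enum.
  by rewrite enum_I3 !inE => /or3P[]/eqP->.
have inc : increasing_indices (ffun3 u v w) = (u < v < w).
  by rewrite /increasing_indices !I3 f0 f1 f2 !inordK //=; lia.
have iso : u < v < w ->
    order_isomorphic pi (monotone3 b, R) (ffun3 u v w) =
    chain3 b (pi u) (pi v) (pi w).
  move=> _; rewrite /order_isomorphic !I3 f0 f1 f2 /chain3 /monotone3.
  case: b => /=; rewrite /perm123 /perm321 ?perm1 ?permE /= ?inordK //=; lia.
have val : chain3 b (pi u) (pi v) (pi w) ->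
    value_bounds pi (ffun3 u v w) =
    bounds3 (lo3 (pi u) (pi v) (pi w)) (pi v) (hi3 (pi u) (pi v) (pi w)).
  rewrite /value_bounds enum_I3 /= f0 f1 f2 /chain3 /lo3 /hi3 => ch.
  rewrite /bounds3; congr cons.
  rewrite -[RHS]/(rcons [:: _; _; _] n.+1); congr rcons.
  apply: (@sorted_eq _ leq); [exact: leq_trans | exact: anti_leq | | | ].
  - exact/sort_sorted/leq_total.
  - by case: b ch => /=; lia.
  - rewrite perm_sort; case: b => //.
    by rewrite -perm_rev.
rewrite /occurrence inc /=; case lt: (u < v < w) => //=; rewrite iso //.
case ch: (chain3 _ _ _ _) => //=.
apply: eq_forallb => box; congr (_ ==> ~~ _); apply: eq_existsb => m.
by rewrite /in_box val // /position_bounds enum_I3 /= f0 f1 f2.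
Qed.

Lemma ex_gap3 (p q r m : nat) :
    p < q < r -> m <= r -> [/\ m <> p, m <> q & m <> r] ->
  exists2 a : 'I_4, a <= 2 & gap (bounds3 p q r) a m.
Proof.
rewrite /gap => pqr mr [mp mq mr']; case: (ltnP m p) => [lp|gp].
  by exists (inord 0); rewrite inordK //=; lia.
case: (ltnP m q) => [lq|gq].
  by exists (inord 1); rewrite inordK //=; lia.
by exists (inord 2); rewrite inordK //=; lia.
Qed.

(** The nine boxes of [R3] near the origin fill the rectangle up to column [w] and the highest
    value, except for the rows and columns of the three points, which hold no other point of
    [pi]. *)
Lemma occurrence_R3E (u v w : 'I_n) :
  occurrence pi (monotone3 b, R3) (ffun3 u v w) =
  [&& u < v < w, chain3 b (pi u) (pi v) (pi w),
      [forall m : 'I_n, (m <= w) && (pi m <= hi3 (pi u) (pi v) (pi w))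
         ==> (m \in [:: u; v; w])]
    & [forall m : 'I_n, (w < m) ==> (pi m <= hi3 (pi u) (pi v) (pi w))]].
Proof.
rewrite occurrence3E; case uvw: (u < v < w) => //=.
case ch: (chain3 _ _ _ _) => //=.
have lohi : lo3 (pi u) (pi v) (pi w) < pi v < hi3 (pi u) (pi v) (pi w).
  by move: ch; rewrite /chain3 /lo3 /hi3; case: b; lia.
apply/'forall_implyP/andP => [H|[/forallP H1 /forallP H2] [a c]]; last first.
  rewrite inE /gap /= => Rac; apply/negP => /existsP[m /andP[ma mc]].
  case/orP: Rac => /andP[].
    move=> a2 c2; have := H1 m.
    have -> : (m <= w) && (pi m <= hi3 (pi u) (pi v) (pi w)).
      move: ma mc; case: a a2 => -[|[|[|]]] //= _ _;
      case: c c2 => -[|[|[|]]] //=; lia.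
    move: ma; rewrite !inE => ma /or3P[]/eqP em; subst m; move: ma;
    case: a a2 => -[|[|[|]]] //=; lia.
  by move=> /eqP a3 /eqP c3; move: (H2 m) ma mc; rewrite a3 c3 /=; lia.
split; apply/forallP => m; apply/implyP.
  case/andP => mw mh; apply: contraT; rewrite !inE !negb_or => /and3P[mu mv mw'].
  have [a a2 ma] : exists2 a : 'I_4, a <= 2 & gap (bounds3 u v w) a m.
    by apply: ex_gap3 => //; split; apply/eqP.
  have [c c2 mc] := ex_gap3 lohi mh
    ltac:(by rewrite /lo3 /hi3; case: b;
             split=> /val_inj/perm_inj/eqP; exact/negP).
  have := H (a, c); rewrite inE /= a2 c2 => /(_ isT)/negP[].
  apply/existsP; exists m.
  by rewrite ma mc.
move=> wm; rewrite leqNgt; apply/negP => hm.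
have := H (inord 3, inord 3); rewrite inE /= inordK //= => /(_ isT)/negP[].
apply/existsP; exists m; have := ltn_ord m; have := ltn_ord (pi m).
rewrite /gap /=; lia.
Qed.

(** All [n - 1 - y] values above [y] occur in the [x + 1] columns up to [x]; the other points of
    these columns are those of the box. *)
Lemma card_box (x y : nat) : x < n -> y < n ->
    (forall m : 'I_n, x < m -> pi m <= y) ->
  #|[set c : 'I_n | (c <= x) && (pi c <= y)]| + n = x + y + 2.
Proof.
move=> xn yn NE.
have cardle z : z < n -> #|[set c : 'I_n | c <= z]| = z.+1.
  move=> zn; have inj : injective (widen_ord zn).
    by move=> i j /(congr1 val)/= /val_inj.
  rewrite -[RHS]card_ord -(card_imset _ inj).
  apply: eq_card => c; rewrite !inE.
  apply/idP/imsetP => [cz|[d _ ->]]; last exact: (ltn_ord d).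
  by exists (Ordinal (cz : c < z.+1)) => //; apply: val_inj.
have := cardsID [set c : 'I_n | pi c <= y] [set c : 'I_n | c <= x].
rewrite cardle //.
have -> : [set c : 'I_n | c <= x] :&: [set c : 'I_n | pi c <= y] =
    [set c : 'I_n | (c <= x) && (pi c <= y)].
  by apply/setP => c; rewrite !inE.
have -> : [set c : 'I_n | c <= x] :\: [set c : 'I_n | pi c <= y] =
    ~: (pi @^-1: [set v : 'I_n | v <= y]).
  apply/setP => c; rewrite !inE; case: (ltnP x c) => [/NE->|_] //=; lia.
have := cardsC (pi @^-1: [set v : 'I_n | v <= y]).
rewrite card_preimset; last exact: perm_inj.
rewrite cardle // card_ord => hC hD.
set k := #|~: _| in hC hD; set l := #|_| in hD.
by change (l + n = x + y + 2); lia.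
Qed.

(** The last index [w] of an occurrence is the corner [x]; [card_box] turns three points into
    [y + w = n + 1] and back. *)
Lemma avoids_R3 : avoids pi (monotone3 b, R3) = (corners b pi == set0).
Proof.
rewrite /avoids ex_ffun3 -[RHS]negbK; congr (~~ _); apply/idP/set0Pn.
  case/existsP=> u /existsP[v /existsP[w]]; rewrite occurrence_R3E.
  case/and4P=> uvw ch /forallP box /forallP NE; exists w.
  set y := hi3 _ _ _ in box NE.
  (* [c] is the column of the highest point: the last one if increasing, the first one if
     decreasing. *)
  have [c cuw yc] : exists2 c, c \in [:: u; w] & y = pi c.
    by rewrite /y /hi3; case: b; [exists w | exists u]; rewrite ?inE ?eqxx ?orbT.
  have [pu pv pw] : [/\ pi u <= y, pi v <= y & pi w <= y].
    by move: ch; rewrite /y /chain3 /hi3; case: b => /= ch; split; lia.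
  have boxE : [set c : 'I_n | (c <= w) && (pi c <= y)] = [set u; v; w].
    apply/setP => d; rewrite inE; apply/idP/idP => [/(implyP (box d))|].
      by rewrite !inE orbA.
    by rewrite !inE -orbA => /or3P[]/eqP->; lia.
  have := @card_box w y (ltn_ord w) ltac:(rewrite yc; exact: ltn_ord)
     (fun m => implyP (NE m)).
  rewrite boxE => card3; have {card3} wy : y + w = n.+1.
    suff e3 : #|[set u; v; w]| = 3 by lia.
    rewrite setUC cardsU1 cards2 !inE -!val_eqE /=; lia.
  rewrite inE; apply/andP; split.
    apply/and3P; split; first by rewrite /inb; lia.
      apply/existsP; exists c; rewrite /inb -yc wy leqnn eqxx !andbT.
      by move: cuw; rewrite !inE => /orP[]/eqP->; lia.
    by apply/forallP => m; apply/implyP => /(implyP (NE m)); lia.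
  have inbE (d : 'I_n) : inb w d (pi d) = (d \in [set u; v; w]).
    by rewrite -boxE inE /inb -wy leq_add2r.
  apply/'forall_forallP => d e; apply/implyP; rewrite !inbE !inE -!orbA.
  case/and3P => /or3P[]/eqP-> /or3P[]/eqP->; move: uvw ch;
    by rewrite /chain3; case: b; lia.
case=> x; rewrite inE => /andP[/and3P[ix + /forallP NE] /'forall_forallP mn].
case/existsP=> c /andP[ic /eqP cx].
set B := [set d : 'I_n | inb x d (pi d)].
have card3 : #|B| = 3.
  have := @card_box x (pi c) (ltn_ord _) (ltn_ord _).
  have <- : B = [set d : 'I_n | (d <= x) && (pi d <= pi c)].
    by apply/setP => d; rewrite !inE /inb -cx leq_add2r.
  suff H : forall m : 'I_n, x < m -> pi m <= pi c by move/(_ H); lia.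
  by move=> m /(implyP (NE m)); lia.
have xB : x \in B by rewrite inE.
(* The rightmost point of the box is in column [x]; the other two columns serve as [u < v]. *)
have := cardsD1 x B; rewrite card3 xB => -[/esym/eqP/cards2P[u [v [uv BE]]]].
wlog {uv} uv : u v BE / u < v.
  move=> W; case: (ltngtP u v) => lt; first exact: (W u v).
    by apply: (W v u) => //; rewrite setUC.
  by case/eqP: uv; apply: val_inj.
have BE' d : d \in B = (d \in [:: u; v; x]).
  by rewrite -(setD1K xB) BE !inE orbC orbA.
have Bu : u \in B by rewrite BE' !inE eqxx.
have Bv : v \in B by rewrite BE' !inE eqxx orbT.
have vx : v < x.
  have : v \in B :\ x by rewrite BE !inE eqxx orbT.
  by rewrite !inE /inb -val_eqE /=; lia.
move: (Bu) (Bv); rewrite !inE => iu iv.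
have := mn u v; have := mn v x; rewrite iu iv ix uv vx /= => mvx muv.
apply/existsP; exists u; apply/existsP; exists v; apply/existsP; exists x.
have puv : pi u != pi v :> nat.
  by rewrite (inj_eq val_inj) (inj_eq perm_inj) -val_eqE neq_ltn uv.
have pvx : pi v != pi x :> nat.
  by rewrite (inj_eq val_inj) (inj_eq perm_inj) -val_eqE neq_ltn vx.
have ch : chain3 b (pi u) (pi v) (pi x).
  by move: muv mvx; rewrite /chain3; case: b => /=; lia.
(* [c] carries the top row of the box, so it is the column of the largest of the three values. *)
have hic : hi3 (pi u) (pi v) (pi x) = pi c.
  have : c \in B by rewrite inE.
  rewrite BE' !inE; move: ch iu iv ix; rewrite /chain3 /hi3 /inb.
  by case: b => ch iu iv ix /or3P[]/eqP ec; move: cx; rewrite ec; lia.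
rewrite occurrence_R3E uv vx ch hic /=; apply/andP; split.
  apply/forallP => m; apply/implyP => /andP[mx mc]; rewrite -BE' inE /inb; lia.
by apply/forallP => m; apply/implyP => /(implyP (NE m)); lia.
Qed.

End Length3.

(** * Rotation by 180 degrees *)

Section Rotation.

Variables (n : nat).

Definition rotate (pi : 'S_n) : 'S_n :=
  (perm (@rev_ord_inj n) * pi * perm (@rev_ord_inj n))%g.

Lemma rotateE pi c : rotate pi c = rev_ord (pi (rev_ord c)).
Proof. by rewrite !permM !permE. Qed.

Lemma rotateK : involutive rotate.
Proof. by move=> pi; apply/permP => c; rewrite !rotateE !rev_ordK. Qed.

(** Each bound [t] becomes [n + 1 - t] and the list is reversed, so gap [a] becomes gap [3 - a]. *)
Lemma rev_gap (p q r m : 'I_n) (a : 'I_4) :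
  gap (bounds3 n (rev_ord r) (rev_ord q) (rev_ord p)) (rev_ord a) (rev_ord m) =
  gap (bounds3 n p q r) a m.
Proof.
rewrite /gap; have := (ltn_ord p, ltn_ord q, ltn_ord r, ltn_ord m).
by case: a => -[|[|[|[|]]]] //= _ [[[]]]; lia.
Qed.

Lemma eq_forallb_bij (T U : finType) (f : T -> U) (P : pred T) (Q : pred U) :
  bijective f -> (forall t, Q (f t) = P t) -> [forall u, Q u] = [forall t, P t].
Proof.
move=> [g fK gK] PQ; apply/forallP/forallP => H t; first by rewrite -PQ.
by rewrite -(gK t) PQ.
Qed.

(** Rotation fixes both 123 and 321, so [b] is kept, and it sends box [(a, c)] to [(3 - a, 3 - c)],
    which carries [R3] onto [R4]. *)
Lemma occurrence_R4_rotate b (pi : 'S_n) (u v w : 'I_n) :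
  occurrence (rotate pi) (monotone3 b, R4)
    (ffun3 (rev_ord w) (rev_ord v) (rev_ord u)) =
  occurrence pi (monotone3 b, R3) (ffun3 u v w).
Proof.
have revlt (c d : 'I_n) : (rev_ord c < rev_ord d) = (d < c).
  by rewrite /=; have := ltn_ord c; have := ltn_ord d; lia.
rewrite !occurrence3E !rotateE !rev_ordK !revlt [(v < w) && _]andbC.
congr [&& _, _ & _].
  by rewrite /chain3 !revlt; case: b; rewrite andbC.
pose f (box : 'I_4 * 'I_4) := (rev_ord box.1, rev_ord box.2).
apply: (@eq_forallb_bij _ _ f).
  by exists f => -[a c]; rewrite /f /= !rev_ordK.
move=> [a c]; congr (_ ==> ~~ _).
  by rewrite !inE; case: a c => -[|[|[|[|]]]] //= _ [[|[|[|[|]]]]].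
rewrite -[LHS]negbK -[RHS]negbK !negb_exists; congr (~~ _).
apply: (eq_forallb_bij (inv_bij (@rev_ordK n))) => m; rewrite rotateE rev_ordK /=.
by rewrite rev_gap; case: b; rewrite /lo3 /hi3 rev_gap.
Qed.

Lemma avoids_R4_rotate b (pi : 'S_n) :
  avoids (rotate pi) (monotone3 b, R4) = avoids pi (monotone3 b, R3).
Proof.
rewrite /avoids !ex_ffun3; congr (~~ _); apply/idP/idP.
  case/existsP=> u /existsP[v /existsP[w occ]].
  apply/existsP; exists (rev_ord w); apply/existsP; exists (rev_ord v).
  by apply/existsP; exists (rev_ord u); rewrite -occurrence_R4_rotate !rev_ordK.
case/existsP=> u /existsP[v /existsP[w occ]].
apply/existsP; exists (rev_ord w); apply/existsP; exists (rev_ord v).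
by apply/existsP; exists (rev_ord u); rewrite occurrence_R4_rotate.
Qed.

Lemma card_avoids_R4 b :
  #|[set pi : 'S_n | avoids pi (monotone3 b, R4)]| =
  #|[set pi : 'S_n | avoids pi (monotone3 b, R3)]|.
Proof.
rewrite -(card_preimset _ (inv_inj rotateK)); apply: eq_card => pi.
by rewrite !inE avoids_R4_rotate.
Qed.

Lemma card_avoids_R3 b b' :
  #|[set pi : 'S_n | avoids pi (monotone3 b, R3)]| =
  #|[set pi : 'S_n | avoids pi (monotone3 b', R3)]|.
Proof.
have avE d : [set pi : 'S_n | avoids pi (monotone3 d, R3)] =
    [set pi | corners d pi == set0].
  by apply/setP => pi; rewrite !inE avoids_R3.
by rewrite !avE; apply: card_corners0.
Qed.

End Rotation.

Theorem theorem2p3 :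
  forall p q : mesh_pattern 3,
    p \in [:: (perm123, R3); (perm321, R3); (perm123, R4); (perm321, R4)] ->
    q \in [:: (perm123, R3); (perm321, R3); (perm123, R4); (perm321, R4)] ->
    wilf_equivalent p q.
Proof.
have key (p : mesh_pattern 3) n :
    p \in [:: (perm123, R3); (perm321, R3); (perm123, R4); (perm321, R4)] ->
  #|[set pi : 'S_n | avoids pi p]| =
  #|[set pi : 'S_n | avoids pi (perm123, R3)]|.
  rewrite !inE => /or4P[]/eqP->.
  - by [].
  - exact: (card_avoids_R3 n false true).
  - exact: (card_avoids_R4 n true).
  - by rewrite (card_avoids_R4 n false) (card_avoids_R3 n false true).
by move=> p q pP qP n _; rewrite key // [RHS]key.
Qed.
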